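(* Let $\mu$ be a translation bounded measure on $\mathbb R^d$ (hence a tempered distribution). Then (i) $\mu$ is weakly almost periodic as a tempered distribution if and only if $\mu$ is a weakly almost periodic measure; (ii) $\mu$ is strongly almost periodic as a tempered distribution if and only if $\mu$ is a strongly almost periodic measure; (iii) $\mu$ is null weakly almost periodic as a tempered distribution if and only if $\mu$ is a null weakly almost periodic measure.
   Context: For a tempered distribution $\psi$ and $f\in\mathcal S(\mathbb R^d)$, $\psi*f(t)=\psi(T_tf_-)$ with $f_-(s)=f(-s)$, $T_tf(x)=f(x-t)$. A tempered distribution $\psi$ is weakly / strongly / null weakly almost periodic if $\psi*f\in WAP(\mathbb R^d)$ / $SAP(\mathbb R^d)$ / $WAP_0(\mathbb R^d)$ for all $f\in\mathcal S$. A measure $\mu$ is a weakly / strongly / null weakly almost periodic measure if $\mu*f\in WAP(\mathbb R^d)$ / $SAP(\mathbb R^d)$ / $WAP_0(\mathbb R^d)$ for all continuous compactly supported $f$. Here $WAP$, $SAP$, $WAP_0$ are the spaces of weakly almost periodic, Bohr almost periodic, and null weakly almost periodic functions. *)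

(* Defs.v *)
From HB Require Import structures.
From mathcomp Require Import all_boot all_order all_algebra.
From mathcomp Require Import all_classical all_reals all_analysis.
From mathcomp.real_closed Require Import complex.
Import Order.TTheory GRing.Theory Num.Theory.
Import numFieldNormedType.Exports.

Set Implicit Arguments.
Unset Strict Implicit.
Unset Printing Implicit Defensive.

Local Open Scope ring_scope.
Local Open Scope classical_set_scope.

Section ComplexNormed.
Variable R : realType.
HB.instance Definition _ := NormedModule.copy R[i] (R[i])^o.
End ComplexNormed.

Section Defs.
Variables (R : realType) (d : nat).

Local Notation Rd := 'rV[R]_d.
Local Notation C := R[i].

Definition cabs (z : C) : R := Normc.normc z.

Definition cR (x : R) : C := Complex x 0.

Definition transl (t : Rd) (g : Rd -> C) : Rd -> C := fun x => g (x - t).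
Definition reflect (g : Rd -> C) : Rd -> C := fun s => g (- s).

Definition Cc (f : Rd -> C) : Prop :=
  continuous f /\ exists K : set Rd, compact K /\ forall x, ~ K x -> f x = 0.

Definition dpart (beta : seq 'I_d) (g : Rd -> R) : Rd -> R :=
  foldr (fun (i : 'I_d) (h : Rd -> R) => fun x => 'D_(delta_mx 0 i) h x) g beta.

Definition monom (alpha : 'I_d -> nat) (x : Rd) : R :=
  \prod_(i < d) (x 0 i) ^+ alpha i.

Definition schwartz_real (g : Rd -> R) : Prop :=
  (forall (beta : seq 'I_d) (i : 'I_d) (x : Rd),
      derivable (dpart beta g) x (delta_mx 0 i)) /\
  (forall (alpha : 'I_d -> nat) (beta : seq 'I_d),
      exists M : R, forall x : Rd, `|monom alpha x * dpart beta g x| <= M).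

Definition schwartz (f : Rd -> C) : Prop :=
  schwartz_real (fun x => complex.Re (f x)) /\
  schwartz_real (fun x => complex.Im (f x)).

Definition Cu (g : Rd -> C) : Prop :=
  (exists M : R, forall x, cabs (g x) <= M) /\
  (forall e : R, 0 < e -> exists2 del : R, 0 < del &
     forall x y : Rd, `|x - y| < del -> cabs (g x - g y) < e).

Definition Cu_dual (phi : (Rd -> C) -> C) : Prop :=
  (forall (a : C) (g1 g2 : Rd -> C), Cu g1 -> Cu g2 ->
     phi (fun x => a * g1 x + g2 x) = a * phi g1 + phi g2) /\
  (exists M : R, forall (g : Rd -> C) (B : R), Cu g ->
     (forall x, cabs (g x) <= B) -> cabs (phi g) <= M * B).

Definition CuDual := {phi : (Rd -> C) -> C | Cu_dual phi}.

Definition weak_ev (g : Rd -> C) : {ptws CuDual -> C} :=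
  fun phi => sval phi g.
Definition weakCu := initial_topology weak_ev.

Definition WAP (f : Rd -> C) : Prop :=
  Cu f /\
  @compact weakCu (closure [set (transl t f : weakCu) | t in [set: Rd]]).

Definition SAP (f : Rd -> C) : Prop :=
  continuous f /\
  forall eps : R, 0 < eps -> exists2 L : R, 0 < L &
    forall a : Rd, exists t : Rd, `|t - a| <= L /\
      forall x : Rd, cabs (f (x + t) - f x) < eps.

(* integral of a real function over the cube [-r, r]^d (iterated Lebesgue
   integrals; coordinates k-1, ..., 0 are integrated, the others are read
   from x) *)
Fixpoint cube_iint (r : R) (k : nat) (g : Rd -> R) (x : Rd) : R :=
  match k with
  | 0 => g x
  | k'.+1 => Rintegral (@lebesgue_measure R) `[- r, r]
      (fun s : R => cube_iint r k' g (\row_j (if (j : nat) == k' then s else x 0 j)))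
  end.
Definition cube_int (r : R) (g : Rd -> R) : R := cube_iint r d g 0.

Definition WAP0 (f : Rd -> C) : Prop :=
  WAP f /\
  (fun n : nat => ((2 * n%:R) ^+ d)^-1 * cube_int n%:R (fun x => cabs (f x)))
    @ \oo --> (0 : R).

Definition Borel := g_sigma_algebraType (@open Rd).

(* A complex Radon measure mu on R^d is represented by its polar
   decomposition mu = h . nu with nu = |mu| a positive Borel measure and
   h a measurable function with |h| = 1. *)
Definition polar_density (h : Rd -> C) : Prop :=
  measurable_fun [set: Borel] (fun x : Borel => complex.Re (h x)) /\
  measurable_fun [set: Borel] (fun x : Borel => complex.Im (h x)) /\
  (forall x, cabs (h x) = 1).

Definition transl_bounded (nu : {measure set Borel -> \bar R}) : Prop :=
  forall K : set Rd, compact K ->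
    exists c : R, forall t : Rd, (nu ([set (x + t)%R | x in K] : set Borel) <= c%:E)%E.

Definition cint (nu : {measure set Borel -> \bar R}) (h : Rd -> C)
  (g : Rd -> C) : C :=
  Complex (Rintegral nu [set: Borel] (fun s : Borel => complex.Re (h s * g s)))
          (Rintegral nu [set: Borel] (fun s : Borel => complex.Im (h s * g s))).

Definition mconv (nu : {measure set Borel -> \bar R}) (h : Rd -> C)
  (f : Rd -> C) (t : Rd) : C := cint nu h (fun s => f (t - s)).

Definition distr_of (nu : {measure set Borel -> \bar R}) (h : Rd -> C) :
  (Rd -> C) -> C := fun f => cint nu h f.

Definition dconv (psi : (Rd -> C) -> C) (f : Rd -> C) (t : Rd) : C :=
  psi (transl t (reflect f)).

Definition WAP_distr (psi : (Rd -> C) -> C) : Prop :=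
  forall f, schwartz f -> WAP (dconv psi f).
Definition SAP_distr (psi : (Rd -> C) -> C) : Prop :=
  forall f, schwartz f -> SAP (dconv psi f).
Definition WAP0_distr (psi : (Rd -> C) -> C) : Prop :=
  forall f, schwartz f -> WAP0 (dconv psi f).

Definition WAP_meas nu h : Prop := forall f, Cc f -> WAP (mconv nu h f).
Definition SAP_meas nu h : Prop := forall f, Cc f -> SAP (mconv nu h f).
Definition WAP0_meas nu h : Prop := forall f, Cc f -> WAP0 (mconv nu h f).

End Defs.

(* Main.v *)
(* Write [w x = 1 / (1 + |x|)^(d+1)]. Covering balls of radius [2^k] by
   [2^(d k)] unit balls shows that translation boundedness of [nu] makes
   [int w (t - s) d nu(s)] bounded in [t]; hence [f |-> mu * f] is continuous
   from the norm [sup |f| / w] to the sup norm. In the former norm a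
   continuous compactly supported function is approximated by Schwartz
   functions (averages of its values against a smooth partition of unity) and
   a Schwartz function by compactly supported ones (cutoffs). It remains to see
   that each of [SAP], [WAP] and [WAP0] is closed under uniform limits; for
   [WAP] this is a diagonal argument along ultrafilters of translations. *)
Require Import Defs.
From HB Require Import structures.
From mathcomp Require Import all_boot all_order all_algebra.
From mathcomp Require Import all_classical all_reals all_analysis.
From mathcomp.real_closed Require Import complex.
From mathcomp Require Import measurable_realfun ring lra.
Import Order.TTheory GRing.Theory Num.Theory.
Import numFieldNormedType.Exports.
Local Open Scope ring_scope.
Local Open Scope classical_set_scope.
Set Implicit Arguments.
Unset Strict Implicit.
Unset Printing Implicit Defensive.

(** * Complex moduli and uniform limits *)

(** Neither class of test functions contains the other, so the approximation has to run both ways;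
    one transfer lemma for an arbitrary class closed under uniform limits then serves all three
    equivalences. The exponent [d + 1] is the first integer that works: the mass of a ball of radius
    [2^k] grows like [2^(d k)], and the weight leaves a geometric series in [2^(-k)]. Mollifying a
    continuous function would require differentiation under an integral in several variables; the
    partition of unity is instead built inside a syntactic class of functions, where smoothness is
    an induction on terms. The weak topology is not metrizable in general, so sequences of
    translations are replaced by ultrafilters on the group of translations: a single one yields
    limits for all approximants at once, which takes the place of extracting subsequences. *)

Section ComplexModulus.
Variable R : realType.
Implicit Types z w : R[i].

Lemma normC_cabs z : `|z| = (cabs z)%:C%C.
Proof. by rewrite normc_def /cabs; case: z. Qed.

Lemma cabs_ge0 z : 0 <= cabs z.
Proof. by case: z => a b; exact: sqrtr_ge0. Qed.

Lemma cabs0 : cabs (0 : R[i]) = 0.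
Proof. exact: Normc.normc0. Qed.

Lemma cabsD z w : cabs (z + w) <= cabs z + cabs w.
Proof. exact: le_normcD. Qed.

Lemma cabsN z : cabs (- z) = cabs z.
Proof. exact: normcN. Qed.

Lemma cabsM z w : cabs (z * w) = cabs z * cabs w.
Proof. exact: Normc.normcM. Qed.

Lemma cabsB z w : cabs (z - w) = cabs (w - z).
Proof. by rewrite -cabsN opprB. Qed.

Lemma cabs_triangle z w u : cabs (z - u) <= cabs (z - w) + cabs (w - u).
Proof. by rewrite (le_trans _ (cabsD _ _))// addrA subrK. Qed.

Lemma cabs_le_dist z w : `|cabs z - cabs w| <= cabs (z - w).
Proof.
have := cabsD (z - w) w; have := cabsD (w - z) z.
by rewrite !subrK (cabsB w z) ler_distl => ? ?; apply/andP; split; lra.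
Qed.

Lemma Re_le_cabs z : `|complex.Re z| <= cabs z.
Proof.
case: z => a b /=; rewrite /cabs/= -sqrtr_sqr ler_wsqrtr// lerDl sqr_ge0//.
Qed.

Lemma Im_le_cabs z : `|complex.Im z| <= cabs z.
Proof.
case: z => a b /=; rewrite /cabs/= -sqrtr_sqr ler_wsqrtr// lerDr sqr_ge0//.
Qed.

Lemma cabs_le_ReIm z : cabs z <= `|complex.Re z| + `|complex.Im z|.
Proof.
case: z => a b /=; rewrite /cabs/= -[leRHS]ger0_norm ?addr_ge0//.
rewrite -sqrtr_sqr ler_wsqrtr// sqrrD !real_normK ?num_real// lerD2r lerDl.
by rewrite mulrn_wge0// mulr_ge0.
Qed.

Lemma cabs_cR (x : R) : cabs (cR x) = `|x|.
Proof. by rewrite /cabs/= expr0n addr0 sqrtr_sqr. Qed.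

Lemma ReB z w : complex.Re (z - w) = complex.Re z - complex.Re w.
Proof. by case: z w => a b []. Qed.

Lemma ImB z w : complex.Im (z - w) = complex.Im z - complex.Im w.
Proof. by case: z w => a b []. Qed.

(** The norm of [R[i]] takes its values in [R[i]], so balls have complex radii; positivity forces
    the imaginary part of a radius to vanish, which gives back a real one. *)
Lemma nbhsC_cabsP z (A : set R[i]) :
  nbhs z A <-> exists2 e : R, 0 < e & forall w, cabs (z - w) < e -> A w.
Proof.
split.
  move=> /nbhs_ballP[e /= e0 eA]; exists (complex.Re e).
    by move: e0; rewrite ltcE => /andP[].
  move=> w zw; apply: eA; rewrite -ball_normE/= normC_cabs.
  by move: e0; rewrite !ltcE/= => /andP[/eqP -> _]; rewrite eqxx.
move=> [e e0 eA]; apply/nbhs_ballP; exists e%:C%C; first by rewrite /= ltcR.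
by move=> w; rewrite -ball_normE/= normC_cabs ltcR => /eA.
Qed.

Lemma continuousC_cabsP (V : normedModType R) (f : V -> R[i]) :
  continuous f <-> forall x (e : R), 0 < e -> exists2 del : R, 0 < del &
    forall y, `|x - y| < del -> cabs (f x - f y) < e.
Proof.
split=> [cf x e e0|cf x A /nbhsC_cabsP[e e0 eA]].
  have /nbhs_ballP[del /= del0 D] : nbhs x (f @^-1` [set w | cabs (f x - w) < e]).
    by apply: cf; apply/nbhsC_cabsP; exists e.
  by exists del => // y xy; apply: D; rewrite -ball_normE.
have [del del0 D] := cf x e e0; apply/nbhs_ballP; exists del => // y.
by rewrite -ball_normE/= => /D/eA.
Qed.

Lemma continuous_Re (V : normedModType R) (f : V -> R[i]) :
  continuous f -> continuous (fun x => complex.Re (f x)).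
Proof.
move=> /continuousC_cabsP cf x; apply/cvgrPdist_lt => e /(cf x)[del del0 D].
apply/nbhs_ballP; exists del => // y; rewrite -ball_normE/= => /D.
by apply: le_lt_trans; rewrite -ReB Re_le_cabs.
Qed.

Lemma continuous_Im (V : normedModType R) (f : V -> R[i]) :
  continuous f -> continuous (fun x => complex.Im (f x)).
Proof.
move=> /continuousC_cabsP cf x; apply/cvgrPdist_lt => e /(cf x)[del del0 D].
apply/nbhs_ballP; exists del => // y; rewrite -ball_normE/= => /D.
by apply: le_lt_trans; rewrite -ImB Im_le_cabs.
Qed.

Lemma continuous_Complex (V : normedModType R) (u v : V -> R) :
  continuous u -> continuous v -> continuous (fun x => Complex (u x) (v x)).
Proof.
move=> cu cv; apply/continuousC_cabsP => x e e0.
have e20 : 0 < e / 2 by rewrite divr_gt0.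
have /cvgrPdist_lt/(_ _ e20)/nbhs_ballP[a a0 A] := cu x.
have /cvgrPdist_lt/(_ _ e20)/nbhs_ballP[b b0 B] := cv x.
exists (Num.min a b); first by rewrite lt_min; apply/andP.
move=> y; rewrite lt_min => /andP[xa xb].
apply: (le_lt_trans (cabs_le_ReIm _)); rewrite ReB ImB/= [e]splitr ltrD//.
  by apply: A; rewrite -ball_normE.
by apply: B; rewrite -ball_normE.
Qed.

End ComplexModulus.

Section UniformLimits.
Variables (R : realType) (d : nat).
Local Notation Rd := 'rV[R]_d.
Local Notation C := R[i].

Definition unif_closed (P : (Rd -> C) -> Prop) : Prop := forall f,
  (forall e : R, 0 < e -> exists2 g, P g & forall x, cabs (f x - g x) <= e) ->
  P f.

Lemma Cu_unif_closed : unif_closed (@Cu R d).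
Proof.
move=> f H; split.
  have [g [[M gM] _] fg] := H 1 ltr01.
  exists (1 + M) => x; rewrite -[f x](subrK (g x)).
  by rewrite (le_trans (cabsD _ _))// lerD.
move=> e e0; have e3 : 0 < e / 3 by rewrite divr_gt0.
have [g [_ /(_ _ e3)[del del0 D]] fg] := H _ e3.
exists del => // x y /D gxy.
have := cabs_triangle (f x) (g x) (f y).
have := cabs_triangle (g x) (g y) (f y).
have := fg x; have := fg y; rewrite (cabsB (f y)); lra.
Qed.

(** An [e / 3]-almost period of an approximant is an [e]-almost period of the limit, so the
    inclusion length [L] carries over unchanged. *)
Lemma SAP_unif_closed : unif_closed (@SAP R d).
Proof.
move=> f H; split.
  apply/continuousC_cabsP => x e e0; have e3 : 0 < e / 3 by rewrite divr_gt0.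
  have [g [/continuousC_cabsP/(_ x _ e3)[del del0 D] _] fg] := H _ e3.
  exists del => // y /D gxy.
  have := cabs_triangle (f x) (g x) (f y).
  have := cabs_triangle (g x) (g y) (f y).
  have := fg x; have := fg y; rewrite (cabsB (f y)); lra.
move=> e e0; have e3 : 0 < e / 3 by rewrite divr_gt0.
have [g [_ /(_ _ e3)[L L0 gL]] fg] := H _ e3.
exists L => // a; have [t [ta gt]] := gL a; exists t; split=> // x.
have := cabs_triangle (f (x + t)) (g (x + t)) (f x).
have := cabs_triangle (g (x + t)) (g x) (f x).
have := fg x; have := fg (x + t); have := gt x; rewrite (cabsB (f x)); lra.
Qed.

End UniformLimits.

(** * Weak almost periodicity *)

Lemma ptws_proj_continuous (I : Type) (T : uniformType) (i : I) :
  continuous (fun g : {ptws I -> T} => g i).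
Proof.
move=> f; have : nbhs f --> f by exact: cvg_id.
by move/cvg_sup/(_ i) => fi W Wfi; apply: fi; exact: initial_continuous.
Qed.

Lemma ptws_cvgP (I : Type) (T : uniformType) (F : set_system (I -> T))
    (f : I -> T) : Filter F ->
  (forall i, (fun g => g i) @ F --> f i) -> F --> (f : {ptws I -> T}).
Proof.
(* The pointwise topology is the supremum of the initial topologies of the evaluations. Each
   evaluation is surjective (constant functions), so convergence may be tested on the image
   filter. *)
move=> FF Ff; apply/cvg_sup => i; rewrite cvg_image//; last first.
  by rewrite eqEsubset; split=> v // _; exists (cst v).
move=> W /(Ff i) FW; exists ((fun g => g i) @^-1` W) => //.
by apply: image_preimage; rewrite eqEsubset; split=> v // _; exists (cst v).
Qed.

Section WeakAlmostPeriodicity.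
Variables (R : realType) (d : nat).
Local Notation Rd := 'rV[R]_d.
Local Notation C := R[i].
Implicit Types (f g : Rd -> C) (phi : CuDual R d) (U : set_system Rd).

(** Weak convergence of the translates of [f], tested functional by functional. The filter lives on
    the translations and not on the orbit of [f], so the same [U] can be used for several
    functions. *)
Definition wlim U f g : Prop := forall phi (e : R), 0 < e ->
  U [set t | cabs (sval phi (transl t f) - sval phi g) < e].

Lemma nbhs_weakCu (g : weakCu R d) phi (e : R) : 0 < e ->
  nbhs g [set g' | cabs (sval phi g - sval phi g') < e].
Proof.
move=> e0; have cw : continuous (@weak_ev R d : weakCu R d -> _).
  exact: initial_continuous.
have : continuous (fun g' : weakCu R d => sval phi g').
  move=> x; apply: (@continuous_comp _ _ _ (@weak_ev R d : weakCu R d -> _)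
    (fun h : {ptws CuDual R d -> C} => h phi)); first exact: cw.
  exact: (@ptws_proj_continuous _ C phi).
move=> /(_ g [set z | cabs (sval phi g - z) < e]); apply.
by apply/nbhsC_cabsP; exists e.
Qed.

Lemma wlim_nbhs U f g (N : set (weakCu R d)) : Filter U ->
  wlim U f g -> nbhs (g : weakCu R d) N -> U [set t | N (transl t f)].
Proof.
move=> FU fg [B [[A oA <-] Ag] BN].
have Acvg : (fun t => weak_ev (transl t f)) @ U --> (weak_ev g : {ptws CuDual R d -> C}).
  apply: (@ptws_cvgP (CuDual R d) C) => phi W /nbhsC_cabsP[e e0 eW].
  change (U [set t | W (sval phi (transl t f))]).
  apply: filterS (fg phi e e0) => t ft.
  by apply: (eW (sval phi (transl t f))); rewrite cabsB.
have : nbhs (weak_ev g) A by exact: open_nbhs_nbhs.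
move=> /Acvg UA; change (U [set t | A (weak_ev (transl t f))]) in UA.
by apply: filterS UA => t At; exact: BN.
Qed.

(** Compactness gives a cluster point of the image of [U]. It is a limit because [U] is ultra: if
    [U] lacked some [A], it would contain the complement of [A], which the cluster point
    excludes. *)
Lemma WAP_wlim f U : WAP f -> UltraFilter U -> exists g, wlim U f g.
Proof.
move=> [_ cO] UU.
have UF := @ultra_proper _ U UU.
pose F := (fun t => transl t f : weakCu R d) @ U.
have FO : F (closure [set (transl t f : weakCu R d) | t in [set: Rd]]).
  apply: (@filterS _ U _ setT) => [t _|]; last exact: filterT.
  by apply: subset_closure; exists t.
have [g [_ clg]] := cO F _ FO.
exists g => phi e e0; set A := [set t | _].
have [//|FnA] := in_ultra_setVsetC A UU.
have FB : F [set g' | ~ cabs (sval phi g - sval phi g') < e].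
  apply: (@filterS _ U _ (~` A)) FnA => t /= + H; apply.
  by rewrite /A/= cabsB.
by have [g' [/= ]] := clg _ _ FB (nbhs_weakCu g phi e0).
Qed.

(* A filter on the closure of the orbit is pulled back to the group through the
   open sets it contains; regularity of the weak topology turns a weak limit
   of the pulled back ultrafilter into a cluster point of the original one. *)
Lemma wlim_WAP f : Cu f ->
  (forall U, UltraFilter U -> exists g, wlim U f g) -> WAP f.
Proof.
move=> cuf Hf; split=> // F FF FO.
pose orb t : weakCu R d := transl t f.
pose G := filter_from [set V : set (weakCu R d) | open V /\ F V]
  (fun V => orb @^-1` V).
have GF : ProperFilter G.
  apply: filter_from_proper.
    apply: filter_from_filter; first by exists setT; split; [exact: openT|exact: filterT].
    move=> V W [oV FV] [oW FW]; exists (V `&` W) => //.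
    by split; [exact: openI|exact: filterI].
  (* An open set that meets the closure of the orbit meets the orbit itself; this is why [G] is
     generated by open sets only. *)
  move=> V [oV FV]; have /filter_ex[x [Vx Ox]] : F (V `&` closure [set orb t | t in setT]).
    exact: filterI.
  by have [_ [[t _ <-] Vt]] := Ox V (open_nbhs_nbhs (conj oV Vx)); exists t.
have [U [UU GU]] := ultraFilterLemma GF.
have [g Ug] := Hf U UU; have UF := @ultra_proper _ U UU.
have gcl : closure [set orb t | t in setT] (g : weakCu R d).
  move=> N /(wlim_nbhs _ Ug)/filter_ex[t Nt].
  by exists (orb t); split => //; exists t.
exists g; split=> // A N FA Ng.
have [//|AN] := pselect (A `&` N !=set0); exfalso.
(* If [A] missed [N], it would lie in the complement of the closure of [N']. This complement is
   open, so its trace on the orbit would belong to [U], together with the trace of [N']. *)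
have [N' N'g N'N] := @uniform_regular (weakCu R d) g N Ng.
have UV : U (orb @^-1` (~` closure N')).
  apply: GU; exists (~` closure N') => //; split.
    exact/closed_openC/closed_closure.
  by apply: filterS FA => x Ax cx; apply: AN; exists x; split=> //; exact: N'N.
have [t [nt N't]] := filter_ex (filterI UV (wlim_nbhs _ Ug N'g)).
by apply: nt; exact: (@subset_closure (weakCu R d)).
Qed.

Lemma Cu_transl t f : Cu f -> Cu (transl t f).
Proof.
move=> [[M fM] fe]; split; first by exists M => x; exact: fM.
move=> e /fe[del del0 D]; exists del => // x y xy; apply: D.
by rewrite opprB addrA subrK.
Qed.

(** Point evaluations make weak limits pointwise limits, which is enough to carry bounds and moduli
    of continuity over to them. *)
Lemma Cu_dual_point (x : Rd) : @Cu_dual R d (fun g => g x).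
Proof.
split; first by [].
by exists 1 => g B _ gB; rewrite mul1r.
Qed.

Definition point_dual (x : Rd) : CuDual R d := exist _ _ (Cu_dual_point x).

Lemma CuDual_bounded phi : exists2 M : R, 0 <= M &
  forall f g (B : R), Cu f -> Cu g -> (forall x, cabs (f x - g x) <= B) ->
    cabs (sval phi f - sval phi g) <= M * B.
Proof.
case: phi => phi [lin [M HM]]/=; exists `|M| => // f g B cf cg fgB.
have B0 : 0 <= B by rewrite (le_trans (cabs_ge0 _) (fgB 0)).
(* [Cu_dual] gives linearity in the form [a * g1 + g2] and the bound only on [Cu], so the difference
   is put in that form and then shown to lie in [Cu]. *)
have -> : phi f - phi g = phi (fun x => (-1) * g x + f x).
  by rewrite lin// mulN1r addrC.
apply: le_trans (ler_wpM2r B0 (ler_norm M)); apply: HM.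
  split.
    have [[Mf fM] _] := cf; have [[Mg gM] _] := cg.
    exists (Mg + Mf) => x; rewrite mulN1r (le_trans (cabsD _ _))// cabsN.
    by rewrite lerD.
  move=> e e0; have e2 : 0 < e / 2 by rewrite divr_gt0.
  have [_ /(_ _ e2)[a a0 A]] := cf; have [_ /(_ _ e2)[b b0 B']] := cg.
  exists (Num.min a b); first by rewrite lt_min; apply/andP.
  move=> x y; rewrite lt_min => /andP[/A fxy /B' gxy].
  rewrite (_ : _ - _ = (f x - f y) - (g x - g y)); last by ring.
  by rewrite (le_lt_trans (cabsD _ _))// cabsN [e]splitr ltrD.
by move=> x; rewrite mulN1r addrC.
Qed.

Lemma wlim_point U f g x (e : R) : wlim U f g -> 0 < e ->
  U [set t | cabs (f (x - t) - g x) < e].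
Proof. by move=> /(_ (point_dual x)); apply. Qed.

Lemma wlim_Cu U f g : ProperFilter U -> Cu f -> wlim U f g -> Cu g.
Proof.
move=> FU [[M fM] fe] fg; split.
  exists (M + 1) => x.
  have /filter_ex[t /= ft] := wlim_point x fg ltr01.
  rewrite -[g x](subrK (f (x - t))) (le_trans (cabsD _ _))// addrC lerD//.
  by rewrite cabsB ltW.
move=> e e0; have e3 : 0 < e / 3 by rewrite divr_gt0.
have [del del0 D] := fe _ e3; exists del => // x y xy.
have [t [/= fx fy]] :=
  filter_ex (filterI (wlim_point x fg e3) (wlim_point y fg e3)).
have fxy : cabs (f (x - t) - f (y - t)) < e / 3.
  by apply: D; rewrite opprB addrA subrK.
have := cabs_triangle (g x) (f (x - t)) (g y).
have := cabs_triangle (f (x - t)) (f (y - t)) (g y).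
rewrite (cabsB (g x) (f _)); lra.
Qed.

Lemma wlim_dist U f1 f2 g1 g2 (e : R) : ProperFilter U ->
  wlim U f1 g1 -> wlim U f2 g2 -> (forall x, cabs (f1 x - f2 x) <= e) ->
  forall x, cabs (g1 x - g2 x) <= e.
Proof.
move=> FU fg1 fg2 fe x; apply/ler_addgt0Pr => a a0.
have a2 : 0 < a / 2 by rewrite divr_gt0.
have [t [/= fx fy]] :=
  filter_ex (filterI (wlim_point x fg1 a2) (wlim_point x fg2 a2)).
have := cabs_triangle (g1 x) (f1 (x - t)) (g2 x).
have := cabs_triangle (f1 (x - t)) (f2 (x - t)) (g2 x).
rewrite (cabsB (g1 x) (f1 _)); have := fe (x - t); lra.
Qed.

(** The intervals of centre [u n] and radius [e n] meet pairwise, so on the line they share a point: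
    the supremum of their left ends. The limit thus comes with its rate. *)
Lemma real_cauchy_limit (u e : nat -> R) :
  (forall n m, `|u n - u m| <= e n + e m) ->
  exists l, forall n, `|u n - l| <= e n.
Proof.
move=> ue; pose A := [set u n - e n | n in [set: nat]].
have ub m : ubound A (u m + e m).
  by move=> _ [n _ <-]; have := ue n m; rewrite ler_norml => /andP[]; lra.
have hA : has_sup A by split; [exists (u 0%N - e 0%N), 0%N|exists (u 0%N + e 0%N)].
exists (sup A) => n; rewrite ler_distlC; apply/andP; split.
  by apply: sup_upper_bound => //; exists n.
by apply: ge_sup => //; case: hA.
Qed.

Lemma WAP_unif_closed : unif_closed (@WAP R d).
Proof.
move=> f Hf; have cuf : Cu f.
  by apply: Cu_unif_closed => e /Hf[g [cg _] fg]; exists g.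
apply: wlim_WAP => // U UU; have UF := @ultra_proper _ U UU.
have e_gt0 n : 0 < n.+1%:R^-1 :> R by [].
have /choice[F HF] n : exists F, WAP F /\ forall x, cabs (f x - F x) <= n.+1%:R^-1.
  by have [g ? ?] := Hf _ (e_gt0 n); exists g.
(* Every [F n] is translated along the same [U], so the limits [G n] inherit the mutual distances of
   the [F n] and form a uniform Cauchy sequence. *)
have /choice[G HG] n : exists G, wlim U (F n) G.
  by apply: WAP_wlim => //; case: (HF n).
have dG n m x : cabs (G n x - G m x) <= n.+1%:R^-1 + m.+1%:R^-1.
  apply: (wlim_dist UF (HG n) (HG m)) => y.
  rewrite (le_trans (cabs_triangle _ (f y) _))// lerD//.
    by rewrite cabsB; case: (HF n) => _; exact.
  by case: (HF m) => _; exact.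
have /choice[a Ha] x : exists l, forall n, `|complex.Re (G n x) - l| <= n.+1%:R^-1.
  by apply: real_cauchy_limit => n m; rewrite -ReB (le_trans (Re_le_cabs _)).
have /choice[b Hb] x : exists l, forall n, `|complex.Im (G n x) - l| <= n.+1%:R^-1.
  by apply: real_cauchy_limit => n m; rewrite -ImB (le_trans (Im_le_cabs _)).
pose g x := Complex (a x) (b x).
have gG n x : cabs (G n x - g x) <= 2 * n.+1%:R^-1.
  rewrite (le_trans (cabs_le_ReIm _))// ReB ImB/= mulr2n mulrDl mul1r.
  by rewrite lerD.
have cuG n : Cu (G n) by apply: wlim_Cu (HG n); case: (HF n) => -[].
have small (e : R) : 0 < e -> exists n, n.+1%:R^-1 < e.
  move=> e0; exists (Num.truncn e^-1).
  by rewrite invf_plt ?posrE// truncnS_gt.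
have cug : Cu g.
  apply: Cu_unif_closed => e e0.
  have [n ne] := small (e / 2) ltac:(by rewrite divr_gt0).
  exists (G n) => // x; rewrite cabsB (le_trans (gG n x))//.
  by rewrite mulrC -ler_pdivlMr// ltW.
exists g => phi e e0; have [M M0 HM] := CuDual_bounded phi.
(* With this [n], passing from [f] to [F n] costs at most [e / 6], from [F n] to [G n] less than
   [e / 6], and from [G n] to [g] at most [e / 3]. The [+ 1] covers [M = 0]. *)
have [n ne] := small (e / (6 * (M + 1))) ltac:(by rewrite divr_gt0// mulr_gt0// ltr_wpDl).
have Mn : M * n.+1%:R^-1 <= e / 6.
  apply: (@le_trans _ _ ((M + 1) * n.+1%:R^-1)).
    by rewrite ler_wpM2r// lerDl.
  rewrite -ler_pdivlMl ?ltr_wpDl//.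
  by rewrite (le_trans (ltW ne))// invfM [leLHS]mulrA mulrC.
have e6 : 0 < e / 6 by rewrite divr_gt0.
apply: filterS (HG n phi _ e6) => t /= ht.
have cuFn : Cu (F n) by case: (HF n) => -[].
have h1 := HM _ _ _ (Cu_transl t cuf) (Cu_transl t cuFn) (fun x => (HF n).2 (x - t)).
have h2 := HM _ _ _ (cuG n) cug (gG n).
have := cabs_triangle (sval phi (transl t f)) (sval phi (transl t (F n))) (sval phi g).
have := cabs_triangle (sval phi (transl t (F n))) (sval phi (G n)) (sval phi g).
move: h1 h2 Mn; set q := _^-1; lra.
Qed.

End WeakAlmostPeriodicity.

(** * Cube means *)

Lemma rV_norm_le (R : realType) n (v : 'rV[R]_n) (r : R) :
  0 <= r -> (forall j, `|v 0 j| <= r) -> `|v| <= r.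
Proof.
move=> r0 vr; rewrite /Num.norm/= mx_normrE; apply/bigmax_leP; split=> //= -[i j] _.
by rewrite /= ord1.
Qed.

Lemma rV_norm_lt (R : realType) n (v : 'rV[R]_n) (r : R) :
  0 < r -> (forall j, `|v 0 j| < r) -> `|v| < r.
Proof.
move=> r0 vr; rewrite /Num.norm/= mx_normrE; apply/bigmax_ltP; split=> //= -[i j] _.
by rewrite /= ord1.
Qed.

Lemma rV_coord_le_norm (R : realType) n (v : 'rV[R]_n) j : `|v 0 j| <= `|v|.
Proof. by rewrite [leRHS]/Num.norm/= mx_normrE; apply: (le_bigmax _ _ (0, j)). Qed.

Lemma compact_rV_ball (R : realType) n (M : R) :
  compact [set x : 'rV[R]_n | `|x| <= M].
Proof.
apply: bounded_closed_compact.
  by exists M; split=> [|N MN x /= xM]; rewrite ?num_real// (le_trans xM) ?ltW.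
rewrite (_ : mkset _ = (fun x : 'rV[R]_n => `|x|) @^-1` [set y | y <= M])//.
apply: closed_comp; [by move=> x _; exact: norm_continuous|exact: closed_le].
Qed.

Section CubeMeans.
Variables (R : realType) (d : nat).
Local Notation Rd := 'rV[R]_d.
Local Notation C := R[i].
Implicit Types (g : Rd -> R).

(** The invariant of the iterated integral: each partial integral inherits it, and it makes every
    one-variable slice integrable over a segment. *)
Definition unif_cont g : Prop := forall e : R, 0 < e ->
  exists2 del : R, 0 < del & forall x y, `|x - y| < del -> `|g x - g y| < e.

Let upd (k : nat) (x : Rd) (s : R) : Rd :=
  \row_j (if (j : nat) == k then s else x 0 j).

Let upd_distl k x s s' : `|upd k x s - upd k x s'| <= `|s - s'|.
Proof.
by apply: rV_norm_le => // j; rewrite !mxE; case: ifP; rewrite // subrr normr0.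
Qed.

Let upd_distr k x y s : `|upd k x s - upd k y s| <= `|x - y|.
Proof.
apply: rV_norm_le => // j; rewrite !mxE; case: ifP; rewrite ?subrr ?normr0//.
by move=> _; rewrite (le_trans _ (rV_coord_le_norm _ j))// !mxE.
Qed.

Let D (r : R) : set R := [set` `[- r, r]%R].

Let upd_integrable g k x (r : R) : unif_cont g ->
  (@lebesgue_measure R).-integrable (D r) (EFin \o (fun s => g (upd k x s))).
Proof.
move=> cg; apply: continuous_compact_integrable; first exact: segment_compact.
apply: continuous_subspaceT => s; apply/cvgrPdist_lt => e /cg[del del0 H].
apply/nbhs_ballP; exists del => // s' ss'; have {}ss' : `|s - s'| < del by [].
by apply: H; rewrite (le_lt_trans (upd_distl _ _ _ _)).
Qed.

Let Rintegral_dist (u v : R -> R) (r e : R) : 0 <= r ->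
  (@lebesgue_measure R).-integrable (D r) (EFin \o u) ->
  (@lebesgue_measure R).-integrable (D r) (EFin \o v) ->
  (forall s, `|u s - v s| <= e) ->
  `|Rintegral (@lebesgue_measure R) (D r) u
    - Rintegral (@lebesgue_measure R) (D r) v| <= e * (2 * r).
Proof.
move=> r0 iu iv uv; have mD : measurable (D r : set (measurableTypeR R)).
  exact: measurable_itv.
have iuv : (@lebesgue_measure R).-integrable (D r) (EFin \o (fun s => u s - v s)).
  exact: (integrableB mD iu iv).
rewrite -RintegralB// (le_trans (le_normr_Rintegral _ _))//.
have -> : e * (2 * r) = Rintegral (@lebesgue_measure R) (D r) (cst e).
  rewrite (_ : 2 * r = fine (lebesgue_measure (D r))).
    exact/esym/Rintegral_cst.
  rewrite /D lebesgue_measure_itv/= lte_fin; case: ltP => [_|rr]/=; lra.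
apply: le_Rintegral => //.
  exact: (integrable_norm iuv).
apply: continuous_compact_integrable; first exact: segment_compact.
by apply: continuous_subspaceT => ?; exact: cvg_cst.
Qed.

Lemma cube_iint_unif_cont g (r : R) k : 0 <= r -> unif_cont g ->
  unif_cont (cube_iint r k g).
Proof.
move=> r0 cg; elim: k => //= k IH e e0.
(* Integrating over a segment multiplies the error by its length [2 * r]; the [+ 1] covers
   [r = 0]. *)
have e'0 : 0 < e / (2 * r + 1) by rewrite divr_gt0// ltr_wpDl// mulr_ge0.
have [del del0 H] := IH _ e'0; exists del => // x y xy.
apply: (@le_lt_trans _ _ (e / (2 * r + 1) * (2 * r))).
  apply: Rintegral_dist => //; [exact: upd_integrable|exact: upd_integrable|].
  by move=> s; rewrite ltW// H// (le_lt_trans (upd_distr _ _ _ _)).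
rewrite mulrAC ltr_pdivrMr ?ltr_wpDl ?mulr_ge0// ltr_pM2l//.
by rewrite ltrDl.
Qed.

Lemma cube_iint_dist g1 g2 (r e : R) k : 0 <= r ->
  unif_cont g1 -> unif_cont g2 -> (forall x, `|g1 x - g2 x| <= e) ->
  forall x, `|cube_iint r k g1 x - cube_iint r k g2 x| <= e * (2 * r) ^+ k.
Proof.
move=> r0 c1 c2 g12; elim: k => [x|k IH x]/=; first by rewrite expr0 mulr1.
rewrite exprSr mulrA; apply: Rintegral_dist => //.
- exact/upd_integrable/cube_iint_unif_cont.
- exact/upd_integrable/cube_iint_unif_cont.
Qed.

Lemma Cu_unif_cont_cabs (f : Rd -> C) : Cu f -> unif_cont (fun x => cabs (f x)).
Proof.
move=> [_ cf] e /cf[del del0 H]; exists del => // x y /H.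
exact/le_lt_trans/cabs_le_dist.
Qed.

(** The mean over a cube is 1-Lipschitz for the sup norm, so the means of [cabs (f x)] stay within
    [e / 2] of means that tend to 0. *)
Lemma WAP0_unif_closed : unif_closed (@WAP0 R d).
Proof.
move=> f Hf; have wf : WAP f.
  by apply: WAP_unif_closed => e /Hf[g [wg _] fg]; exists g.
split=> //; apply/cvgrPdist_lt => e e0.
have e2 : 0 < e / 2 by rewrite divr_gt0.
have [g [wg /cvgrPdist_lt/(_ _ e2) g0] fg] := Hf _ e2.
apply: filterS g0 => n; rewrite !sub0r !normrN => gn.
set c := (2 * n%:R) ^+ d in gn *.
have c0 : 0 <= c by rewrite exprn_ge0// mulr_ge0.
set a := cube_int _ _ in gn; set b := cube_int _ _.
have ab : `|b - a| <= e / 2 * c.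
  apply: cube_iint_dist => //; [exact: Cu_unif_cont_cabs wf.1|exact: Cu_unif_cont_cabs wg.1|].
  by move=> x; rewrite (le_trans (cabs_le_dist _ _)).
have : `|c^-1 * b - c^-1 * a| <= e / 2.
  rewrite -mulrBr normrM ger0_norm ?invr_ge0//.
  rewrite (le_trans (ler_wpM2l _ ab)) ?invr_ge0// mulrCA ler_piMr ?(ltW e2)//.
  (* The volume [c] vanishes when [n = 0] and [d > 0]; its inverse is then 0 by convention and the
     bound still holds. *)
  by have [->|cN0] := eqVneq c 0; rewrite ?mulr0// mulVf.
move=> H; rewrite -[_ * b](subrK (c^-1 * a)) (le_lt_trans (ler_normD _ _))//.
by rewrite [e]splitr ler_ltD.
Qed.

End CubeMeans.

(** * Convolution with a translation bounded measure *)

Section ConvolutionBound.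
Variables (R : realType) (d : nat).
Local Notation Rd := 'rV[R]_d.
Local Notation C := R[i].

Definition weight (x : Rd) : R := ((1 + `|x|) ^+ d.+1)^-1.

Lemma weight_gt0 x : 0 < weight x.
Proof. by rewrite invr_gt0 exprn_gt0// ltr_pwDl. Qed.

Lemma weight_ge0 x : 0 <= weight x.
Proof. exact/ltW/weight_gt0. Qed.

Let cball (t : Rd) (r : R) : set (Borel R d) := [set s : Rd | `|t - s| <= r].

Lemma continuous_Borel_measurable (u : Rd -> R) : continuous u ->
  measurable_fun [set: Borel R d] (u : Borel R d -> R).
Proof.
move=> /continuousP cu; apply: (measurability _ (RGenOpens.measurableE R)).
move=> _ [_ [a [b ->] <-]]; rewrite setTI; apply: sub_sigma_algebra.
exact/cu/interval_open.
Qed.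

Lemma continuous_dist (V : normedModType R) (t : V) :
  continuous (fun s : V => `|t - s|).
Proof.
move=> s; apply: cvg_norm; apply: cvgB; [exact: cvg_cst|exact: cvg_id].
Qed.

Let measurable_cball t r : measurable (cball t r).
Proof.
have mf := continuous_Borel_measurable (@continuous_dist _ t).
have := mf measurableT _ (measurable_itv `]-oo, r]%R); rewrite setTI.
by congr measurable; apply/seteqP; split=> s; rewrite /cball/= in_itv.
Qed.

Lemma measurable_weight t :
  measurable_fun [set: Borel R d] (fun s : Borel R d => weight (t - s)).
Proof.
have c1 : continuous (fun s : Rd => 1 + `|t - s|).
  move=> s; exact: (cvgD (cvg_cst _) (@continuous_dist _ t s)).
have c2 : continuous (fun s : Rd => (1 + `|t - s|) ^+ d.+1).
  move=> s; exact: (continuous_comp (c1 s) (@exprn_continuous _ d.+1 _)).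
apply: continuous_Borel_measurable => s.
have N0 : (1 + `|t - s|) ^+ d.+1 != 0 by rewrite gt_eqF// exprn_gt0// ltr_pwDl.
exact: (cvgV N0 (c2 s)).
Qed.

Variable nu : {measure set (Borel R d) -> \bar R}.

(** Balls of the sup norm are cubes: a cube of radius [2 * r] is covered by [2 ^ d] cubes of radius
    [r], one for each choice of signs in the centre [t] plus or minus [r]. *)
Let cball_double t (r : R) (c : R) : 0 <= r ->
  (forall u, (nu (cball u r) <= c%:E)%E) ->
  (nu (cball t (2 * r)) <= (2 ^+ d * c)%:E)%E.
Proof.
move=> r0 Hc.
pose I := {ffun 'I_d -> bool}.
pose ctr (f : I) : Rd := t + \row_j (if f j then r else - r).
(* The cubes are renumbered by naturals, with the empty set past the end, as subadditivity is stated
   for sequences. *)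
pose B (k : nat) : set (Borel R d) :=
  if insub k is Some i then cball (ctr (@enum_val I predT i)) r else set0.
have mB k : measurable (B k) by rewrite /B; case: insub => [i|]; [exact: measurable_cball|].
apply: (@le_trans _ _ (\sum_(k < #|I|) nu (B k))%E).
  apply: content_subadditive => //.
  move=> s /= ts; rewrite -bigcup_mkord.
  pose f : I := [ffun j => t 0 j <= s 0 j].
  exists (enum_rank f); first exact: ltn_ord.
  rewrite /B (valK (enum_rank f)) enum_rankK /cball/=.
  apply: rV_norm_le => // j; rewrite !mxE ffunE.
  have := le_trans (rV_coord_le_norm (t - s) j) ts.
  rewrite !mxE !ler_norml => /andP[h1 h2].
  by case: (leP (t 0 j) (s 0 j)) => ?; apply/andP; split; lra.
apply: (@le_trans _ _ (\sum_(k < #|I|) c%:E)%E).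
  apply: lee_sum => k _; rewrite /B (valK k); exact: Hc.
rewrite sumEFin lee_fin big_const_ord iter_addr_0 card_ffun card_bool card_ord.
by rewrite -natrX mulr_natl.
Qed.

Hypothesis nu_tb : transl_bounded nu.

Let cball_pow2 : exists2 c : R, 0 <= c & forall k t,
  (nu (cball t (2 ^+ k)) <= (c * (2 ^+ d) ^+ k)%:E)%E.
Proof.
have [c Hc] := nu_tb (@compact_rV_ball R d 1).
have Hc1 t : (nu (cball t 1) <= c%:E)%E.
  rewrite (_ : cball t 1 = [set x + t | x in [set x : Rd | `|x| <= 1]])//.
  apply/seteqP; split=> [s ts|_ [x /= x1 <-]].
    by exists (s - t); rewrite /= ?subrK// distrC.
  by rewrite /cball/= opprD addrCA subrr addr0 normrN.
exists c.
  by rewrite -lee_fin (le_trans _ (Hc1 0)).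
elim=> [|k IH] t; first by rewrite !expr0 mulr1.
rewrite exprS (le_trans (cball_double _ _ (IH)))// ?exprn_ge0//.
by rewrite exprS mulrCA.
Qed.

Lemma transl_bounded_weight : exists2 c : R, 0 <= c & forall t,
  (\int[nu]_(s in [set: Borel R d]) (weight (t - s))%:E <= c%:E)%E.
Proof.
have [c c0 Hc] := cball_pow2.
exists (2 ^+ d.+1 * (c * 2)); first by rewrite !mulr_ge0// exprn_ge0.
move=> t.
(* For [2 ^ (k - 1) < |x| <= 2 ^ k] the weight is at most [2 ^ (- (k - 1) (d + 1))], which is [q k].
   So the weight is dominated by the sum of the [F k], the relevant [k] being the least one with
   [|x| <= 2 ^ k]. *)
pose q (k : nat) : R := 2 ^+ d.+1 * ((2 ^+ d.+1) ^+ k)^-1.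
have q0 k : 0 <= q k by rewrite mulr_ge0 ?invr_ge0 ?exprn_ge0.
pose F k (s : Borel R d) : \bar R := ((q k)%:E * (\1_(cball t (2 ^+ k)) s)%:E)%E.
have F0 k s : (0 <= F k s)%E by rewrite mule_ge0// lee_fin.
have mF k : measurable_fun [set: Borel R d] (fun s : Borel R d => F k s).
  apply: measurable_funeM; apply/measurable_EFinP; exact: measurable_indic.
have mw : measurable_fun [set: Borel R d] (fun s : Rd => (weight (t - s))%:E).
  apply/measurable_EFinP; exact: measurable_weight.
apply: (@le_trans _ _ (\int[nu]_(s in [set: Borel R d]) \sum_(k <oo) F k s)%E).
  apply: ge0_le_integral => //.
  - by move=> s _; rewrite lee_fin weight_ge0.
  - exact: ge0_emeasurable_sum.
  move=> s _; set x := t - s.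
  have [k wk xk] : exists2 k, weight x <= q k & `|x| <= 2 ^+ k.
    have [x1|x1] := leP `|x| 1.
      exists 0%N => //; rewrite /q expr0 invr1 mulr1.
      apply: (@le_trans _ _ 1); last by rewrite exprn_ege1// ler1n.
      by rewrite invf_le1 ?exprn_gt0 ?ltr_pwDl// exprn_ege1// lerDl.
    have ex : exists k, `|x| <= 2 ^+ k.
      exists (Num.truncn `|x|).+1; rewrite (le_trans (ltW (truncnS_gt _)))//.
      by rewrite -natrX ler_nat ltnW// ltn_expl.
    have := ex_minnP ex; case=> -[|k] xk kmin; first by move: xk; rewrite expr0 leNgt x1.
    exists k.+1 => //.
    have kx : 2 ^+ k < `|x| by rewrite ltNge; apply/negP => /kmin; rewrite ltnn.
    rewrite /q [_ ^+ d.+1 ^+ k.+1]exprS invfM mulrA mulfV ?expf_neq0// mul1r exprAC.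
    rewrite lef_pV2 ?posrE ?exprn_gt0// ?ltr_pwDl//.
    by rewrite lerXn2r ?nnegrE ?exprn_ge0 ?addr_ge0// (le_trans (ltW kx))// lerDr.
  apply: (@le_trans _ _ (\sum_(0 <= i < k.+1) F i s)%E); last exact: nneseries_lim_ge.
  rewrite big_nat_recr//= (@le_trans _ _ (F k s))//; last first.
    by rewrite leeDr// sume_ge0.
  by rewrite /F indicE mem_set// mule1 lee_fin.
rewrite integral_nneseries//.
(* Each term is at most [q k * c * 2 ^ (d k) = 2 ^ (d + 1) * c / 2 ^ k], written as the total
   divided by [2 ^ (k + 1)] to match the geometric sum. *)
apply: (@le_trans _ _ (\sum_(k <oo) ((2 ^+ d.+1 * (c * 2)) / (2 ^ k.+1)%:R)%:E)%E);
  last by apply: epsilon_trick0; rewrite !mulr_ge0// exprn_ge0.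
apply: lee_nneseries => [k _ _|k _]; first exact: integral_ge0.
rewrite ge0_integralZl_EFin//; last first.
  by apply/measurable_EFinP; exact: measurable_indic.
rewrite integral_indic// setIT.
apply: (le_trans (lee_wpmul2l _ (Hc k t))); first by rewrite lee_fin.
rewrite -EFinM lee_fin /q.
rewrite natrX -!mulrA ler_pM2l ?exprn_gt0// [2 ^+ d.+1]exprS exprMn [2 ^+ k.+1]exprS.
have p2 m : (2 ^+ m : R) != 0 by rewrite expf_neq0.
have a0 : (2 ^+ d : R) ^+ k != 0 by rewrite expf_neq0.
have b0 := p2 k.
by rewrite le_eqVlt; apply/orP; left; apply/eqP; field; apply/andP.
Qed.

Lemma weight_integral_bound : exists2 c : R, 0 <= c &
  forall t (u : Borel R d -> R) (a : R), 0 <= a ->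
    measurable_fun [set: Borel R d] (fun s : Borel R d => u s) ->
    (forall s, `|u s| <= a * weight (t - s)) ->
    nu.-integrable [set: Borel R d] (EFin \o u) /\
    `|Rintegral nu [set: Borel R d] u| <= a * c.
Proof.
have [c c0 Hc] := transl_bounded_weight; exists c => // t u a a0 mu uw.
have aw : nu.-integrable [set: Borel R d] (EFin \o (fun s => a * weight (t - s))).
  apply/integrableP; split.
    apply/measurable_EFinP; apply: measurable_funM; first exact: measurable_cst.
    exact: measurable_weight.
  apply: (@le_lt_trans _ _ (a * c)%:E); last exact: ltry.
  under eq_integral => s _ do
    rewrite /= ger0_norm ?mulr_ge0 ?weight_ge0// EFinM.
  rewrite ge0_integralZl_EFin//; last 2 first.
  - by move=> s _; rewrite lee_fin weight_ge0.
  - apply/measurable_EFinP; exact: measurable_weight.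
  by rewrite EFinM lee_wpmul2l// lee_fin.
have iu : nu.-integrable [set: Borel R d] (EFin \o u).
  apply: (le_integrable measurableT _ _ aw); first exact/measurable_EFinP.
  by move=> s _; rewrite lee_fin (le_trans (uw s))// ler_norm.
split=> //; rewrite (le_trans (le_normr_Rintegral _ _))//.
apply: (@le_trans _ _ (Rintegral nu [set: Borel R d] (fun s => a * weight (t - s)))).
  apply: le_Rintegral => //; exact: (integrable_norm iu).
rewrite /Rintegral -lee_fin fineK ?integrable_fin_num//.
under eq_integral => s _ do rewrite EFinM.
rewrite ge0_integralZl_EFin//; last 2 first.
- by move=> s _; rewrite lee_fin weight_ge0.
- apply/measurable_EFinP; exact: measurable_weight.
by rewrite EFinM lee_wpmul2l// lee_fin.
Qed.

Variable h : Rd -> C.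
Hypothesis ph : polar_density h.

(** The constant [a] only makes both integrals exist, so that they may be subtracted; the estimate
    depends on [e] alone. The factor 2 in the constant comes from bounding real and imaginary parts
    separately. *)
Lemma mconv_dist : exists2 c : R, 0 <= c &
  forall (f g : Rd -> C) (a e : R), 0 <= a -> 0 <= e ->
    continuous f -> continuous g ->
    (forall x, cabs (f x) <= a * weight x) ->
    (forall x, cabs (g x) <= a * weight x) ->
    (forall x, cabs (f x - g x) <= e * weight x) ->
    forall t, cabs (mconv nu h f t - mconv nu h g t) <= e * c.
Proof.
have [c c0 Hc] := weight_integral_bound; have [mRe [mIm h1]] := ph.
exists (2 * c); first by rewrite mulr_ge0.
move=> f g a e a0 e0 cf cg fa ga fge t.
have cts (k : Rd -> R) : continuous k -> continuous (fun s : Rd => k (t - s)).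
  by move=> ck s; exact: (continuous_comp (cvgB (cvg_cst _) cvg_id) (ck _)).
have mcts (k : Rd -> R) : continuous k ->
    measurable_fun [set: Borel R d] (fun s : Borel R d => k (t - s)).
  by move=> /cts; exact: continuous_Borel_measurable.
have mR (k : Rd -> C) : continuous k ->
    measurable_fun [set: Borel R d] (fun s : Borel R d => complex.Re (h s * k (t - s))).
  move=> ck; have -> : (fun s : Borel R d => complex.Re (h s * k (t - s))) =
    (fun s => complex.Re (h s) * complex.Re (k (t - s)) - complex.Im (h s) * complex.Im (k (t - s))).
    by apply/funext => s; case: (h s) => ? ?; case: (k _).
  exact: (measurable_funB (measurable_funM mRe (mcts _ (continuous_Re ck)))
    (measurable_funM mIm (mcts _ (continuous_Im ck)))).
have mI (k : Rd -> C) : continuous k ->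
    measurable_fun [set: Borel R d] (fun s : Borel R d => complex.Im (h s * k (t - s))).
  move=> ck; have -> : (fun s : Borel R d => complex.Im (h s * k (t - s))) =
    (fun s => complex.Re (h s) * complex.Im (k (t - s)) + complex.Im (h s) * complex.Re (k (t - s))).
    by apply/funext => s; case: (h s) => ? ?; case: (k _).
  exact: (measurable_funD (measurable_funM mRe (mcts _ (continuous_Im ck)))
    (measurable_funM mIm (mcts _ (continuous_Re ck)))).
have hk (k : Rd -> C) s : cabs (h s * k (t - s)) = cabs (k (t - s)).
  by rewrite cabsM h1 mul1r.
have bR (k : Rd -> C) b : (forall x, cabs (k x) <= b * weight x) ->
    forall s, `|complex.Re (h s * k (t - s))| <= b * weight (t - s).
  by move=> kb s; rewrite (le_trans (Re_le_cabs _))// hk.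
have bI (k : Rd -> C) b : (forall x, cabs (k x) <= b * weight x) ->
    forall s, `|complex.Im (h s * k (t - s))| <= b * weight (t - s).
  by move=> kb s; rewrite (le_trans (Im_le_cabs _))// hk.
have [ifR _] := Hc t _ _ a0 (mR f cf) (bR f a fa).
have [igR _] := Hc t _ _ a0 (mR g cg) (bR g a ga).
have [ifI _] := Hc t _ _ a0 (mI f cf) (bI f a fa).
have [igI _] := Hc t _ _ a0 (mI g cg) (bI g a ga).
rewrite (le_trans (cabs_le_ReIm _))// ReB ImB/= mulrCA mulr2n mulrDl mul1r.
rewrite -!RintegralB// lerD//; apply: (Hc t _ _ e0 _ _).2.
- by apply: measurable_funB; [exact: mR|exact: mR].
- by move=> s; rewrite -ReB -mulrBr (le_trans (Re_le_cabs _))// cabsM h1 mul1r.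
- by apply: measurable_funB; [exact: mI|exact: mI].
- by move=> s; rewrite -ImB -mulrBr (le_trans (Im_le_cabs _))// cabsM h1 mul1r.
Qed.

End ConvolutionBound.

(** * Smooth functions *)

Section FlatFunction.
Variable R : realType.
Implicit Types (x y : R) (n : nat).

(** The case [n = 0] is the classical smooth function that vanishes for [x <= 0]. The negative
    powers are included so that derivatives are combinations of members of the family. *)
Definition flat n x : R := if 0 < x then x^-1 ^+ n * expR (- x^-1) else 0.

Lemma flat_ge0 n x : 0 <= flat n x.
Proof.
rewrite /flat; case: ifP => // x0.
by rewrite mulr_ge0 ?expR_ge0// exprn_ge0// invr_ge0 ltW.
Qed.

Lemma flat_gt0 x : 0 < x -> 0 < flat 0 x.
Proof. by rewrite /flat => ->; rewrite expr0 mul1r expR_gt0. Qed.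

Lemma flat_eq0 n x : x <= 0 -> flat n x = 0.
Proof. by rewrite /flat ltNge => ->. Qed.

Lemma flat_neq0 n x : flat n x != 0 -> 0 < x.
Proof. by apply: contra_neqT; rewrite -leNgt => /flat_eq0. Qed.

(** With [y = 1 / x], this is the exponential series bound [y ^ (n + 1) / (n + 1)! <= exp y]. The
    linear rate yields the derivative at 0. *)
Lemma flat_le n x : flat n x <= (n.+1)`!%:R * `|x|.
Proof.
rewrite /flat; case: ifP => x0; last by rewrite mulr_ge0.
have y0 : 0 < x^-1 by rewrite invr_gt0.
rewrite gtr0_norm// expRN -[leRHS](mulfK (lt0r_neq0 (expR_gt0 x^-1))).
rewrite ler_pM2r ?invr_gt0 ?expR_gt0//.
have := expR_ge1Dxn n (ltW y0); rewrite -lerBrDl => H.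
have {}H : x^-1 ^+ n.+1 / n.+1`!%:R <= expR x^-1.
  by rewrite (le_trans H)// lerBlDr lerDl.
have f0 : 0 < n.+1`!%:R :> R by rewrite ltr0n fact_gt0.
have -> : x^-1 ^+ n = n.+1`!%:R * x * (x^-1 ^+ n.+1 / n.+1`!%:R).
  by rewrite exprS; field; rewrite !gt_eqF.
by rewrite ler_wpM2l// mulr_ge0 ?ltW.
Qed.

Definition flat' n x : R := - n%:R * flat n.+1 x + flat n.+2 x.

Lemma is_derive_flat n x : is_derive x 1 (flat n) (flat' n x).
Proof.
have [x0|x0|->] := ltgtP x 0.
- rewrite /flat' !flat_eq0 ?ltW// mulr0 addr0.
  apply: (@near_eq_is_derive _ _ _ (cst 0)).
  near=> y; rewrite flat_eq0//; apply: ltW; near: y; exact: lt_nbhsl.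
- apply: (@near_eq_is_derive _ _ _ (fun y => (y^-1) ^+ n * expR (- y^-1))).
    by near=> y; rewrite /flat ifT//; near: y; exact: lt_nbhsr.
  have xN0 : x != 0 by rewrite gt_eqF.
  have dV : is_derive x 1 (fun y : R => y^-1) (- x ^- 2).
    by have := is_deriveV xN0 (is_derive_id x 1); rewrite [_ *: 1]mulr1.
  have dX := is_deriveX n dV.
  have dE : is_derive x 1 (expR \o (fun y : R => - y^-1))
      (expR (- x^-1) * (- - x ^- 2)).
    exact: (@is_derive1_comp _ expR (fun y : R => - y^-1) x _ _ _ (is_deriveN dV)).
  have -> : (fun y : R => y^-1 ^+ n * expR (- y^-1)) =
      ((fun y : R => y^-1) ^+ n) * (expR \o (fun y : R => - y^-1)).
    by apply/funext => y; rewrite /= mulrfctE exprfctE.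
  apply: (is_derive_eq (is_deriveM dX dE)).
  rewrite /flat' /flat x0 /= exprfctE /GRing.scale/= opprK.
  case: n {dX} => [|n] /=; rewrite ?mulr0n ?scale0r; first by rewrite oppr0 !mul0r mulr0 addr0 add0r expr0 mul1r mulrC exprVn.
  rewrite -mulr_natl /GRing.scale/= -exprVn !exprS; ring.
- rewrite /flat' !flat_eq0// mulr0 addr0.
  have key : (fun h : R => h^-1 *: ((flat n \o shift 0) (h *: (1 : R)) - flat n 0)) @ 0^' --> (0 : R).
    apply/cvgrPdist_le => e e0; near=> h.
    rewrite /= addr0 [_ *: 1]mulr1 (flat_eq0 n (lexx 0)) subr0 sub0r normrN.
    (* The difference quotient at 0 is again a member of the family, and [flat_le] sends it to 0. *)
    have -> : h^-1 *: flat n h = flat n.+1 h.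
      rewrite /flat /GRing.scale/=; case: ifP => _; last by rewrite mulr0.
      by rewrite mulrA exprS.
    rewrite ger0_norm ?flat_ge0// (le_trans (flat_le _ _))//.
    rewrite mulrC -ler_pdivlMr ?ltr0n ?fact_gt0//.
    near: h; apply: dnbhs0_le.
    by rewrite divr_gt0// ltr0n fact_gt0.
  apply: DeriveDef; first by apply/cvg_ex; exists 0.
  exact: (cvg_lim _ key).
Unshelve. all: by end_near. Qed.

End FlatFunction.

(** * Smooth functions of several variables and partitions of unity *)

Section ElementarySmooth.
Variables (R : realType) (d : nat).
Local Notation Rd := 'rV[R]_d.
Implicit Types (f g u : Rd -> R).

(* A class of functions stable under partial derivatives and rich enough to
   contain the normalized bumps below. *)
Inductive esmooth : (Rd -> R) -> Prop :=
| esmooth_cst c : esmooth (fun=> c)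
| esmooth_coord i : esmooth (fun x => x 0 i)
| esmooth_add f g : esmooth f -> esmooth g -> esmooth (fun x => f x + g x)
| esmooth_mul f g : esmooth f -> esmooth g -> esmooth (fun x => f x * g x)
| esmooth_flat n f : esmooth f -> esmooth (fun x => flat n (f x))
| esmooth_inv f : (forall x, f x != 0) -> esmooth f ->
    esmooth (fun x => (f x)^-1).

Lemma differentiable_flat n (y : R) : differentiable (flat n) y.
Proof. by apply/derivable1_diffP; case: (is_derive_flat n y). Qed.

(** Total differentiability, not just directional derivatives, is what the chain rule for [flat n]
    after [f] uses in [esmooth_derive]. *)
Lemma esmooth_differentiable f : esmooth f -> forall x, differentiable f x.
Proof.
elim=> {f} [c|i|f g _ IHf _ IHg|f g _ IHf _ IHg|n f _ IHf|f f0 _ IHf] x.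
- exact: differentiable_cst.
- exact: differentiable_coord.
- exact: differentiableD.
- exact: differentiableM.
- exact: (differentiable_comp (IHf x) (differentiable_flat n (f x))).
- exact: differentiableV.
Qed.

Lemma esmooth_continuous f : esmooth f -> continuous f.
Proof.
by move=> sf x; apply: differentiable_continuous; exact: esmooth_differentiable.
Qed.

Lemma is_derive_coord (x v : Rd) i : is_derive x v (fun y : Rd => y 0 i) (v 0 i).
Proof.
have key : (fun h : R => h^-1 *: (((fun y : Rd => y 0 i) \o shift x) (h *: v)
    - x 0 i)) @ 0^' --> v 0 i.
  apply: cvg_near_cst; near=> h.
  rewrite /= !mxE addrK /GRing.scale/= mulrA mulVf ?mul1r//.
  by near: h; exact: nbhs_dnbhs_neq.
apply: DeriveDef; first by apply/cvg_ex; exists (v 0 i).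
exact: (cvg_lim _ key).
Unshelve. all: by end_near. Qed.

Lemma esmooth_derive f v : esmooth f ->
  exists2 f', esmooth f' & forall x, is_derive x v f (f' x).
Proof.
elim=> {f} [c|i|f g _ [f' sf' df] _ [g' sg' dg]|f g sf [f' sf' df] sg [g' sg' dg]
  |n f sf [f' sf' df]|f f0 sf [f' sf' df]].
- exists (fun=> 0) => [|x]; [exact: esmooth_cst|exact: is_derive_cst].
- exists (fun=> v 0 i) => [|x]; [exact: esmooth_cst|exact: is_derive_coord].
- exists (fun x => f' x + g' x) => [|x]; first exact: esmooth_add.
  exact: (is_deriveD (df x) (dg x)).
- exists (fun x => f x * g' x + g x * f' x) => [|x].
    by apply: esmooth_add; exact: esmooth_mul.
  exact: (is_deriveM (df x) (dg x)).
- exists (fun x => f' x * (- n%:R * flat n.+1 (f x) + flat n.+2 (f x))) => [|x].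
    apply: esmooth_mul => //; apply: esmooth_add; last exact: esmooth_flat.
    by apply: esmooth_mul; [exact: esmooth_cst|exact: esmooth_flat].
  have dfx := esmooth_differentiable sf x.
  have dnf := differentiable_flat n (f x).
  have dc := differentiable_comp dfx dnf.
  apply: DeriveDef; first exact: (diff_derivable dc).
  rewrite (deriveE _ dc) (diff_comp dfx dnf)/= deriv1E; last exact/derivable1_diffP.
  have [_ fv] := df x; have [_ flv] := is_derive_flat n (f x).
  by rewrite -(deriveE _ dfx) fv derive1E flv.
- exists (fun x => - ((f x)^-1 * (f x)^-1) * f' x) => [|x].
    have sV := esmooth_inv f0 sf.
    apply: esmooth_mul => //; rewrite (_ : (fun x => _) =
      (fun x => -1 * ((f x)^-1 * (f x)^-1))); last first.
      by apply/funext => x; rewrite mulN1r.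
    by apply: esmooth_mul; [exact: esmooth_cst|exact: esmooth_mul].
  have [fv fv'] := df x.
  apply: DeriveDef; first exact: derivableV.
  by rewrite deriveV// fv' -expr2 exprVn.
Qed.

Lemma esmooth_sum (I : Type) (r : seq I) (F : I -> Rd -> R) :
  (forall i, esmooth (F i)) -> esmooth (fun x => \sum_(i <- r) F i x).
Proof.
move=> sF; elim: r => [|i r IH].
  by under eq_fun do rewrite big_nil; exact: esmooth_cst.
by under eq_fun do rewrite big_cons; exact: esmooth_add.
Qed.

Lemma esmooth_prod (I : Type) (r : seq I) (F : I -> Rd -> R) :
  (forall i, esmooth (F i)) -> esmooth (fun x => \prod_(i <- r) F i x).
Proof.
move=> sF; elim: r => [|i r IH].
  by under eq_fun do rewrite big_nil; exact: esmooth_cst.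
by under eq_fun do rewrite big_cons; exact: esmooth_mul.
Qed.

Lemma esmooth_exp f n : esmooth f -> esmooth (fun x => f x ^+ n).
Proof.
move=> sf; elim: n => [|n IH].
  by under eq_fun do rewrite expr0; exact: esmooth_cst.
by under eq_fun do rewrite exprS; exact: esmooth_mul.
Qed.

Lemma esmooth_dpart f beta : esmooth f -> esmooth (dpart beta f).
Proof.
move=> sf; elim: beta => //= i beta IH.
have [f' sf' df] := esmooth_derive (delta_mx 0 i) IH.
rewrite (_ : (fun x => _) = f')//.
by apply/funext => x; have [] := df x.
Qed.

(** The region [M < |x|] is open, so a function that vanishes there is locally constant there and so
    are its derivatives. *)
Lemma dpart_eq0 f beta (M : R) : (forall x, M < `|x| -> f x = 0) ->
  forall x, M < `|x| -> dpart beta f x = 0.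
Proof.
move=> f0; elim: beta => //= i beta IH x Mx.
rewrite (@near_eq_derive _ _ _ _ (cst 0)); first exact: derive_cst.
have : nbhs x ((fun y : Rd => `|y|) @^-1` [set r | M < r]).
  exact: (@norm_continuous R Rd x [set r | M < r] (lt_nbhsr Mx)).
by apply: filterS => y /IH.
Qed.

Lemma esmooth_schwartz_real f (M : R) : esmooth f ->
  (forall x, M < `|x| -> f x = 0) -> schwartz_real f.
Proof.
move=> sf f0; split=> [beta i x|alpha beta].
  have [f' _ df] := esmooth_derive (delta_mx 0 i) (esmooth_dpart beta sf).
  by case: (df x).
pose u (x : Rd) := monom alpha x * dpart beta f x.
have su : esmooth u.
  apply: esmooth_mul; last exact: esmooth_dpart.
  by apply: esmooth_prod => i; apply: esmooth_exp; exact: esmooth_coord.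
have K := @compact_rV_ball R d M.
have [N [_ NB]] : bounded_set (u @` [set x : Rd | `|x| <= M]).
  apply: (@compact_bounded R R^o).
  apply: continuous_compact => //; apply: continuous_subspaceT.
  exact: esmooth_continuous.
exists (`|N| + 1) => x; have [xM|Mx] := leP `|x| M.
  by apply: (NB (`|N| + 1)); [rewrite (le_lt_trans (ler_norm N))// ltrDl|exists x].
by rewrite (dpart_eq0 _ f0)// mulr0 normr0.
Qed.

(** The value 2 makes [1 < B x] an open condition that holds near [p]; finitely many such regions
    cover a compact set, and the sum of their bumps is at least 1 on it. *)
Lemma esmooth_bump (p : Rd) (r : R) : 0 < r -> exists B : Rd -> R,
  [/\ esmooth B, forall x, 0 <= B x, B p = 2 &
      forall x, B x != 0 -> `|x - p| < r].
Proof.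
move=> r0.
pose b (x : Rd) := \prod_(j < d) (flat 0 (r + - (x 0 j - p 0 j)) * flat 0 (r + (x 0 j - p 0 j))).
have bp : b p = flat 0 r ^+ 2 ^+ d.
  rewrite /b; under eq_bigr do rewrite subrr oppr0 addr0 -expr2.
  by rewrite prodr_const card_ord.
have bp0 : 0 < b p by rewrite bp !exprn_gt0// flat_gt0.
exists (fun x => 2 / b p * b x); split.
- apply: esmooth_mul; first exact: esmooth_cst.
  have sc (c : R) j : esmooth (fun x : Rd => c * (x 0 j - p 0 j)).
    apply: esmooth_mul; first exact: esmooth_cst.
    by apply: esmooth_add; [exact: esmooth_coord|exact: esmooth_cst].
  apply: esmooth_prod => j; apply: esmooth_mul; apply: esmooth_flat;
    apply: esmooth_add; try exact: esmooth_cst.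
    by under eq_fun do rewrite -mulN1r; exact: sc.
  by under eq_fun do rewrite -[_ - _]mul1r; exact: sc.
- move=> x; rewrite mulr_ge0 ?divr_ge0 ?(ltW bp0)//.
  by apply: prodr_ge0 => j _; rewrite mulr_ge0// flat_ge0.
- by rewrite divfK// gt_eqF.
- move=> x; rewrite mulf_eq0 negb_or => /andP[_ bx].
  apply: rV_norm_lt => // j; move/prodf_neq0/(_ j isT): bx.
  rewrite mulf_eq0 negb_or !mxE => /andP[/flat_neq0 h1 /flat_neq0 h2].
  by rewrite ltr_norml; apply/andP; split; lra.
Qed.

(* Normalizing a finite family of bumps that covers [K]: adding
   [flat 0 (1 - D)] to the sum [D] of the bumps keeps the denominator positive
   everywhere and leaves it unchanged on [K], where [1 <= D]. *)
Lemma esmooth_approx u (K : set Rd) (e : R) : 0 < e -> continuous u ->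
  compact K -> (forall x, ~ K x -> u x = 0) ->
  exists g, [/\ esmooth g,
    forall M : R, (forall p, K p -> `|p| <= M) ->
      forall x, M + 1 < `|x| -> g x = 0 &
    forall x, `|u x - g x| <= e].
Proof.
move=> e0 cu cK u0.
have /choice[B HB] p : exists B : Rd -> R, [/\ esmooth B, forall x, 0 <= B x,
    B p = 2 & forall x, B x != 0 -> `|x - p| < 1 /\ `|u p - u x| < e].
  have /cvgrPdist_lt/(_ _ e0)/nbhs_ballP[r r0 Hr] := cu p.
  (* The radius [r] controls the oscillation of [u] on the bump, and the cap 1 keeps the support of
     [g] within distance 1 of [K]. *)
  have m0 : 0 < Num.min 1 r by rewrite lt_min ltr01.
  have [B [sB B0 Bp Br]] := esmooth_bump p m0; exists B; split=> // x /Br.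
  rewrite lt_min => /andP[x1 xr]; split=> //.
  by apply: Hr; rewrite -ball_normE/= distrC.
have := cK; rewrite compact_cover.
move=> /(_ _ K (fun p => [set x | 1 < B p x])) [p _|x Kx|D0 DK KD].
- have [/esmooth_continuous cB _ _ _] := HB p.
  by move/continuousP: cB => /(_ [set y | 1 < y]); apply; exact: open_gt.
- by exists x => //=; have [_ _ -> _] := HB x; rewrite ltr1n.
pose D : seq Rd := finmap.enum_fset D0.
pose S (x : Rd) := \sum_(p <- D) B p x.
pose E (x : Rd) := S x + flat 0 (1 + -1 * S x).
have S0 x : 0 <= S x by apply: sumr_ge0 => p _; have [_ B0 _ _] := HB p.
have SK x : K x -> 1 <= S x.
  move=> /KD[p pD Bp]; have {}pD : p \in D by [].
  rewrite /S (big_rem p)//= (le_trans (ltW Bp))//.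
  by rewrite lerDl sumr_ge0// => q _; have [_ B0 _ _] := HB q.
have E0 x : 0 < E x.
  have [Sx|Sx] := leP 1 (S x).
    by rewrite ltr_wpDr ?flat_ge0// (lt_le_trans ltr01).
  by rewrite ltr_wpDl// flat_gt0// mulN1r subr_gt0.
have sS : esmooth S by apply: esmooth_sum => p; have [] := HB p.
have sE : esmooth E.
  apply: esmooth_add => //; apply/esmooth_flat/esmooth_add; first exact: esmooth_cst.
  by apply: esmooth_mul => //; exact: esmooth_cst.
pose g (x : Rd) := (\sum_(p <- D) u p * B p x) * (E x)^-1.
exists g; split.
- apply: esmooth_mul; last by apply: esmooth_inv => // x; rewrite gt_eqF.
  apply: esmooth_sum => p; apply: esmooth_mul; first exact: esmooth_cst.
  by have [] := HB p.
- move=> M KM x Mx; rewrite /g big_seq big1 ?mul0r// => p pD.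
  have [->|Bx] := eqVneq (B p x) 0; first by rewrite mulr0.
  have [_ _ _ /(_ _ Bx)[xp _]] := HB p; exfalso; move: Mx; apply/negP.
  have /KM pM : K p by move: (DK p pD); rewrite inE.
  rewrite -leNgt -[x](subrK p) addrC (le_trans (ler_normD _ _))//.
  by rewrite lerD// ltW.
move=> x; have uE : u x * flat 0 (1 + -1 * S x) = 0.
  have [/SK Sx|/u0 ->] := pselect (K x); last by rewrite mul0r.
  by rewrite flat_eq0 ?mulr0// mulN1r subr_le0.
(* By [uE], [u x * E x = u x * S x]. The error is therefore a combination of the [u x - u p] with
   nonnegative weights of total [S x / E x <= 1], and [u] varies by less than [e] wherever [B p] is
   nonzero. *)
have -> : u x - g x = (\sum_(p <- D) (u x - u p) * B p x) / E x.
  rewrite /g -[u x in LHS](mulfK (lt0r_neq0 (E0 x))) -mulrBl mulrDr uE addr0.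
  by congr (_ / _); rewrite mulr_sumr -sumrB; apply: eq_bigr => p _; rewrite mulrBl.
rewrite normrM normfV (gtr0_norm (E0 x)) ler_pdivrMr//.
apply: (@le_trans _ _ (e * S x)); last by rewrite ler_pM2l// lerDl flat_ge0.
rewrite (le_trans (ler_norm_sum _ _ _))// mulr_sumr ler_sum// => p _.
have [_ B0 _ Bu] := HB p; rewrite normrM (ger0_norm (B0 x)).
have [->|Bx] := eqVneq (B p x) 0; first by rewrite !mulr0.
by rewrite ler_wpM2r// distrC ltW//; have [] := Bu _ Bx.
Qed.

End ElementarySmooth.

(** * Approximation in the weighted norm *)

Section Approximation.
Variables (R : realType) (d : nat).
Local Notation Rd := 'rV[R]_d.
Local Notation C := R[i].

Lemma partial_lipschitz (g : Rd -> R) i (M : R) :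
  (forall x, derivable g x (delta_mx 0 i)) ->
  (forall x, `|'D_(delta_mx 0 i) g x| <= M) ->
  forall x (s : R), `|g (s *: delta_mx 0 i + x) - g x| <= M * `|s|.
Proof.
move=> dg gM x s; pose phi (s : R) := g (s *: delta_mx 0 i + x).
have dphi (t : R) : is_derive t 1 phi ('D_(delta_mx 0 i) g (t *: delta_mx 0 i + x)).
  have E : (fun h : R => h^-1 *: ((phi \o shift t) (h *: (1 : R)) - phi t)) =
    (fun h : R => h^-1 *: ((g \o shift (t *: delta_mx 0 i + x)) (h *: delta_mx 0 i)
      - g (t *: delta_mx 0 i + x))).
    by apply/funext => h; rewrite /phi /= [h *: 1]mulr1 scalerDl addrA.
  apply: DeriveDef; first by rewrite /derivable E; exact: dg.
  by rewrite /derive E.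
have cphi : continuous phi.
  move=> t; apply: differentiable_continuous; apply/derivable1_diffP.
  by case: (dphi t).
have -> : g x = phi 0 by rewrite /phi scale0r add0r.
have key (a b : R) : a <= b -> `|phi b - phi a| <= M * (b - a).
  move=> ab; have [c _ ->] := MVT_segment ab (fun t _ => dphi t)
    (continuous_subspaceT cphi).
  by rewrite normrM [`|b - a|]ger0_norm ?subr_ge0// ler_wpM2r// subr_ge0.
have [s0|s0] := leP 0 s.
  by have := key _ _ s0; rewrite subr0 [`|s|]ger0_norm.
by have := key _ _ (ltW s0); rewrite sub0r [`|s|]ltr0_norm// distrC.
Qed.

Lemma schwartz_real_bounded (g : Rd -> R) beta : schwartz_real g ->
  exists M : R, forall x, `|dpart beta g x| <= M.
Proof.
move=> [_ /(_ (fun=> 0%N) beta)[M HM]]; exists M => x.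
by have := HM x; rewrite /monom big1 ?mul1r.
Qed.

(** Existence of partial derivatives does not imply continuity in several variables, but their
    boundedness does: changing one coordinate at a time from [x] to [y] gives the Lipschitz constant
    [d * M]. *)
Lemma schwartz_real_continuous (g : Rd -> R) : schwartz_real g -> continuous g.
Proof.
move=> sg; have /choice[L HL] i : exists M : R, forall x,
    `|'D_(delta_mx 0 i) g x| <= M by exact: (schwartz_real_bounded [:: i] sg).
pose M : R := \sum_i `|L i|.
have LM i : L i <= M.
  rewrite (le_trans (ler_norm _))// /M (bigD1 i)//= lerDl sumr_ge0//.
have M0 : 0 <= M by exact: sumr_ge0.
pose z (x y : Rd) k : Rd := \row_j (if (j < k)%N then y 0 j else x 0 j).
have gz x y k : (k <= d)%N -> `|g (z x y k) - g x| <= k%:R * (M * `|y - x|).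
  elim: k => [_|k IH kd].
    rewrite mul0r (_ : z x y 0 = x) ?subrr ?normr0//.
    by apply/rowP => j; rewrite mxE.
  pose i := Ordinal kd.
  have -> : z x y k.+1 = (y - x) 0 i *: delta_mx 0 i + z x y k.
    apply/rowP => j; rewrite !mxE eqxx /= ltnS leq_eqVlt.
    have [jk|jk] := eqVneq j i; first by rewrite jk eqxx/= ltnn mulr1 subrK.
    by rewrite mulr0 add0r (_ : (j == k :> nat) = false)//; apply/negbTE.
  rewrite -[g (_ + _)](subrK (g (z x y k))) -addrA (le_trans (ler_normD _ _))//.
  rewrite -natr1 mulrDl mul1r [leRHS]addrC lerD ?IH 1?ltnW//.
  apply: (le_trans (partial_lipschitz (M := M) _ _ _ _)).
  - by move=> w; exact: (sg.1 [::] i w).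
  - by move=> w; rewrite (le_trans (HL i w)).
  - by rewrite ler_wpM2l// rV_coord_le_norm.
have lip x y : `|g y - g x| <= d%:R * M * `|y - x|.
  have := gz x y d (leqnn d); rewrite mulrA (_ : z x y d = y)//.
  by apply/rowP => j; rewrite mxE ltn_ord.
move=> x A /nbhs_ballP[e e0 eA].
have k0 : 0 < d%:R * M + 1 by rewrite ltr_wpDl// mulr_ge0.
apply/nbhs_ballP; exists (e / (d%:R * M + 1)); first exact: divr_gt0.
move=> y; rewrite -ball_normE/= ltr_pdivlMr// mulrC => xy.
apply: eA; rewrite -ball_normE/=; apply: le_lt_trans xy.
by rewrite (le_trans (lip y x))// ler_wpM2r// lerDl.
Qed.

(** The sup norm of [x] is attained at some coordinate, so the pure powers [x_i ^ n] suffice. The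
    factor [2 ^ n] comes from [1 + |x| <= 2 max(1, |x|)]. *)
Lemma schwartz_real_decay (g : Rd -> R) n : schwartz_real g ->
  exists2 A : R, 0 <= A & forall x, `|g x| * (1 + `|x|) ^+ n <= A.
Proof.
move=> sg; have [M0 HM0] := schwartz_real_bounded [::] sg.
have /choice[L HL] (i : 'I_d) : exists M : R,
    forall x : Rd, `|x 0 i ^+ n * g x| <= M.
  have [M HM] := sg.2 (fun j => if j == i then n else 0%N) [::].
  exists M => x; have := HM x; rewrite /monom/= (bigD1 i)//= eqxx big1 ?mulr1//.
  by move=> j /negbTE ->; rewrite expr0.
have S0 : 0 <= \sum_i `|L i| by exact: sumr_ge0.
exists (2 ^+ n * (`|M0| + \sum_i `|L i|)) => [|x].
  by rewrite mulr_ge0 ?exprn_ge0// addr_ge0.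
have [x1|x1] := leP `|x| 1.
  rewrite mulrC ler_pM ?exprn_ge0 ?addr_ge0//.
    by rewrite lerXn2r ?nnegrE ?addr_ge0// -[2]/(1 + 1) lerD2l.
  by rewrite (le_trans (HM0 x))// (le_trans (ler_norm _))// lerDl.
have xN0 : mx_norm x != 0 by rewrite gt_eqF// (lt_trans ltr01 x1).
have [[a i] /= xi] := mx_norm_neq0 xN0; rewrite ord1 in xi.
have {}xi : `|x| = `|x 0 i| by exact: xi.
have -> : 2 ^+ n * (`|M0| + \sum_i `|L i|) = (`|M0| + \sum_i `|L i|) * 2 ^+ n.
  by rewrite mulrC.
apply: (@le_trans _ _ (`|g x| * (`|x 0 i| * 2) ^+ n)).
  rewrite ler_wpM2l// lerXn2r ?nnegrE ?addr_ge0 ?mulr_ge0//.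
  by rewrite xi mulr2n mulrDr mulr1 lerD2r -xi ltW.
rewrite exprMn mulrA ler_wpM2r ?exprn_ge0// mulrC -normrX -normrM.
rewrite (le_trans (HL i x))// (le_trans (ler_norm _))// (bigD1 i)//= addrCA lerDl.
by rewrite addr_ge0// sumr_ge0.
Qed.

Lemma schwartz_continuous (f : Rd -> C) : schwartz f -> continuous f.
Proof.
move=> [/schwartz_real_continuous cr /schwartz_real_continuous ci].
rewrite (_ : f = fun x => Complex (complex.Re (f x)) (complex.Im (f x))).
  exact: continuous_Complex.
by apply/funext => x; case: (f x).
Qed.

Lemma schwartz_weight (f : Rd -> C) : schwartz f ->
  exists2 A : R, 0 <= A & forall x, cabs (f x) <= A / (1 + `|x|) * weight x.
Proof.
move=> [/(schwartz_real_decay d.+2)[A A0 HA] /(schwartz_real_decay d.+2)[B B0 HB]].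
exists (A + B) => [|x]; first exact: addr_ge0.
have x0 : 0 < 1 + `|x| by rewrite ltr_pwDl.
rewrite /weight -mulrA -invfM -exprS ler_pdivlMr ?exprn_gt0//.
by rewrite (le_trans (ler_wpM2r _ (cabs_le_ReIm _))) ?exprn_ge0 ?(ltW x0)// mulrDl lerD.
Qed.

(* Everything is absorbed by [A / (1 + N) <= e], the gain of one power of
   [1 + `|x|] over the weight. *)
Lemma schwartz_approx_Cc (f : Rd -> C) (e : R) : 0 < e -> schwartz f ->
  exists g, exists2 a : R, 0 <= a & [/\ Cc g, continuous f,
    forall x, cabs (f x) <= a * weight x, forall x, cabs (g x) <= a * weight x &
    forall x, cabs (f x - g x) <= e * weight x].
Proof.
move=> e0 sf; have cf := schwartz_continuous sf.
have [A A0 fA] := schwartz_weight sf.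
have fA' x : cabs (f x) <= A * weight x.
  rewrite (le_trans (fA x))// ler_wpM2r ?weight_ge0//.
  by rewrite ler_piMr// invf_le1 ?ltr_pwDl// lerDl.
pose N := A / e; have N0 : 0 <= N by rewrite divr_ge0// ltW.
(* A piecewise linear cutoff, 1 for [|x| <= N] and 0 for [|x| >= N + 1]; continuity is all that [Cc]
   asks. *)
pose chi (x : Rd) : R := Num.max 0 (Num.min 1 (N + 1 - `|x|)).
have chi0 x : 0 <= chi x by rewrite le_max lexx.
have chi1 x : chi x <= 1 by rewrite ge_max ler01 ge_min lexx.
have cchi : continuous chi.
  move=> x; apply: (@continuous_max R Rd (fun=> 0) (fun x => Num.min 1 (N + 1 - `|x|))).
    exact: (@cst_continuous Rd R^o).
  apply: (@continuous_min R Rd (fun=> 1) (fun x => N + 1 - `|x|)).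
    exact: (@cst_continuous Rd R^o).
  exact: (cvgB (cvg_cst _) (@norm_continuous R Rd x)).
pose g x := Complex (chi x * complex.Re (f x)) (chi x * complex.Im (f x)).
have gE x : g x = cR (chi x) * f x.
  by rewrite /g /cR; case: (f x) => a b /=; apply/eqP; rewrite eq_complex/= !mul0r subr0 addr0 !eqxx.
have fgE x : f x - g x = cR (1 - chi x) * f x.
  rewrite /g /cR; case: (f x) => a b /=; apply/eqP; rewrite eq_complex/=.
  by rewrite !mul0r subr0 addr0 !mulrBl !mul1r !eqxx.
have Cg : Cc g.
  split.
    apply: continuous_Complex => x.
      by apply: continuousM; [exact: cchi|exact: (continuous_Re cf)].
    by apply: continuousM; [exact: cchi|exact: (continuous_Im cf)].
  exists [set x : Rd | `|x| <= N + 1]; split; first exact: compact_rV_ball.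
  move=> x /negP; rewrite -ltNge => Nx; rewrite gE.
  rewrite (_ : chi x = 0) ?mul0r//.
  by apply/max_idPl; rewrite ge_min; apply/orP; right; rewrite subr_le0 ltW.
have gA x : cabs (g x) <= A * weight x.
  rewrite gE cabsM cabs_cR ger0_norm// (le_trans _ (fA' x))//.
  by rewrite ler_piMl// cabs_ge0.
exists g; exists A; first exact: A0.
split; [exact: Cg|exact: cf|exact: fA'|exact: gA|] => x.
rewrite fgE cabsM cabs_cR ger0_norm ?subr_ge0//.
have [xN|Nx] := leP `|x| N.
  rewrite (_ : chi x = 1) ?subrr ?mul0r ?mulr_ge0 ?weight_ge0 ?(ltW e0)//.
  rewrite /chi min_l; first exact: max_r.
  by rewrite addrAC lerDr subr_ge0.
apply: (@le_trans _ _ (cabs (f x))).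
  by rewrite ler_piMl ?cabs_ge0// lerBlDr lerDl.
rewrite (le_trans (fA x))// ler_wpM2r ?weight_ge0// ler_pdivrMr ?ltr_pwDl//.
by rewrite mulrC -ler_pdivrMr// -/N (le_trans (ltW Nx))// lerDr.
Qed.

Lemma bounded_support_weight (u : Rd -> R) (M : R) : continuous u ->
  (forall x, M < `|x| -> u x = 0) ->
  exists2 a : R, 0 <= a & forall x, `|u x| <= a * weight x.
Proof.
move=> cu u0; pose v (x : Rd) : R := u x * (1 + `|x|) ^+ d.+1.
have cv : continuous v.
  move=> x; apply: (cvgM (cu x)).
  have c1 : {for x, continuous (fun y : Rd => 1 + `|y|)}.
    exact: (cvgD (cvg_cst _) (@norm_continuous R Rd x)).
  exact: (continuous_comp c1 (@exprn_continuous _ d.+1 _)).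
have [N [_ NB]] : bounded_set (v @` [set x : Rd | `|x| <= M]).
  apply: (@compact_bounded R R^o); apply: continuous_compact.
    exact: continuous_subspaceT.
  exact: compact_rV_ball.
exists (`|N| + 1); first by rewrite addr_ge0.
move=> x; have x0 : 0 < (1 + `|x|) ^+ d.+1 by rewrite exprn_gt0// ltr_pwDl.
rewrite /weight ler_pdivlMr//; have [xM|Mx] := leP `|x| M.
  rewrite -[X in _ * X](gtr0_norm x0) -normrM.
  by apply: (NB (`|N| + 1)); [rewrite (le_lt_trans (ler_norm N))// ltrDl|exists x].
by rewrite u0// normr0 mul0r addr_ge0.
Qed.

Lemma Cc_approx_schwartz (f : Rd -> C) (e : R) : 0 < e -> Cc f ->
  exists g, exists2 a : R, 0 <= a & [/\ schwartz g, continuous g,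
    forall x, cabs (f x) <= a * weight x, forall x, cabs (g x) <= a * weight x &
    forall x, cabs (f x - g x) <= e * weight x].
Proof.
move=> e0 [cf [K [cK f0]]].
have [N [_ NB]] := compact_bounded cK.
pose M : R := `|N| + 1.
have KM p : K p -> `|p| <= M.
  by move=> Kp; apply: (NB M) => //; rewrite (le_lt_trans (ler_norm N))// ltrDl.
have M0 : 0 <= M by rewrite addr_ge0.
(* The minimum of the weight on the ball of radius [M + 1], which contains the supports of [f] and
   of its approximants. A uniform error [e * m / 2] in each component is thus at most [e * weight x]
   in total. *)
pose m : R := ((1 + (M + 1)) ^+ d.+1)^-1.
have m0 : 0 < m by rewrite invr_gt0 exprn_gt0// ltr_pwDl// addr_ge0.
have mw (x : Rd) : `|x| <= M + 1 -> m <= weight x.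
  move=> xM; rewrite /m /weight lef_pV2.
  - by rewrite lerXn2r ?nnegrE ?addr_ge0// lerD2l.
  - by rewrite posrE exprn_gt0// ltr_pwDl// addr_ge0.
  - by rewrite posrE exprn_gt0// ltr_pwDl.
have fM x : M + 1 < `|x| -> f x = 0.
  move=> Mx; apply: f0 => /KM; rewrite leNgt => /negP; apply.
  by rewrite (lt_trans _ Mx)// ltrDl.
have e'0 : 0 < e * m / 2 by rewrite divr_gt0// mulr_gt0.
have rf x : ~ K x -> complex.Re (f x) = 0 by move=> /f0 ->.
have jf x : ~ K x -> complex.Im (f x) = 0 by move=> /f0 ->.
have [g [sg gM fg]] := esmooth_approx e'0 (continuous_Re cf) cK rf.
have [k [sk kM fk]] := esmooth_approx e'0 (continuous_Im cf) cK jf.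
have {}gM := gM M KM; have {}kM := kM M KM.
have [a1 a10 H1] := bounded_support_weight (esmooth_continuous sg) gM.
have [a2 a20 H2] := bounded_support_weight (esmooth_continuous sk) kM.
have [a3 a30 H3] : exists2 a : R, 0 <= a & forall x, `|complex.Re (f x)| <= a * weight x.
  by apply: (bounded_support_weight (M := M + 1) (continuous_Re cf)) => x /fM ->.
have [a4 a40 H4] : exists2 a : R, 0 <= a & forall x, `|complex.Im (f x)| <= a * weight x.
  by apply: (bounded_support_weight (M := M + 1) (continuous_Im cf)) => x /fM ->.
exists (fun x => Complex (g x) (k x)), (a1 + a2 + (a3 + a4)).
  by rewrite !addr_ge0.
split.
- by split; [exact: esmooth_schwartz_real sg gM|exact: esmooth_schwartz_real sk kM].
- exact: continuous_Complex (esmooth_continuous sg) (esmooth_continuous sk).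
- move=> x; rewrite (le_trans (cabs_le_ReIm _))// mulrDl ler_wpDl//.
    by rewrite mulr_ge0 ?weight_ge0// addr_ge0.
  by rewrite mulrDl lerD.
- move=> x; rewrite (le_trans (cabs_le_ReIm _))//= mulrDl ler_wpDr//.
    by rewrite mulr_ge0 ?weight_ge0// addr_ge0.
  by rewrite mulrDl lerD.
move=> x; have [xM|Mx] := leP `|x| (M + 1).
  rewrite (le_trans (cabs_le_ReIm _))// ReB ImB/= (@le_trans _ _ (e * m))//.
    by rewrite [e * m]splitr lerD.
  by rewrite ler_pM2l// mw.
rewrite fM// gM// kM// subrr cabs0 mulr_ge0 ?weight_ge0//; exact: ltW.
Qed.

End Approximation.

(** * Transfer between the two classes of test functions *)

Lemma dconv_distr_of (R : realType) (d : nat)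
    (nu : {measure set (Borel R d) -> \bar R}) (h f : 'rV[R]_d -> R[i]) :
  dconv (distr_of nu h) f = mconv nu h f.
Proof.
(* Reflection followed by translation gives [f (- (s - t)) = f (t - s)]: both sides are the same
   convolution, and only the test functions differ. *)
apply/funext => t; rewrite /dconv /distr_of /mconv.
by congr cint; apply/funext => s; rewrite /transl /Defs.reflect opprB.
Qed.

Lemma unif_closed_distr_meas (R : realType) (d : nat)
    (nu : {measure set (Borel R d) -> \bar R}) (h : 'rV[R]_d -> R[i])
    (P : ('rV[R]_d -> R[i]) -> Prop) :
  polar_density h -> transl_bounded nu -> unif_closed P ->
  (forall f, schwartz f -> P (dconv (distr_of nu h) f)) <->
  (forall f, Cc f -> P (mconv nu h f)).
Proof.
move=> ph tb clP; have [c c0 Hc] := mconv_dist tb ph.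
have ec (e : R) : 0 < e -> exists2 e', 0 < e' & e' * c <= e.
  (* The denominator [c + 1] covers [c = 0]. *)
  move=> e0; exists (e / (c + 1)); first by rewrite divr_gt0// ltr_wpDl.
  by rewrite mulrAC ler_pdivrMr ?ltr_wpDl// ler_pM2l// lerDl.
split=> HP f Hf; rewrite ?dconv_distr_of; apply: clP => e /ec[e' e'0 e'c].
- have [g [a a0 [sg cg fa ga fg]]] := Cc_approx_schwartz e'0 Hf.
  exists (mconv nu h g) => [|t]; first by rewrite -dconv_distr_of; exact: HP.
  apply: le_trans e'c; apply: (Hc f g a e' a0 (ltW e'0) _ cg fa ga fg t).
  by case: Hf.
- have [g [a a0 [cg cf fa ga fg]]] := schwartz_approx_Cc e'0 Hf.
  exists (mconv nu h g) => [|t]; first exact: HP.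
  apply: le_trans e'c; apply: (Hc f g a e' a0 (ltW e'0) cf _ fa ga fg t).
  by case: cg.
Qed.

Theorem theorem5p12 (R : realType) (d : nat)
  (nu : {measure set (Borel R d) -> \bar R}) (h : 'rV[R]_d -> R[i]) :
  polar_density h -> transl_bounded nu ->
  (WAP_distr (distr_of nu h) <-> WAP_meas nu h) /\
  (SAP_distr (distr_of nu h) <-> SAP_meas nu h) /\
  (WAP0_distr (distr_of nu h) <-> WAP0_meas nu h).
Proof.
move=> ph tb; split; [|split]; apply: unif_closed_distr_meas => //.
- exact: WAP_unif_closed.
- exact: SAP_unif_closed.
- exact: WAP0_unif_closed.
Qed.
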